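(* Let $G=(V,E)$ be a connected graph and let $S_G=(v_1,\dots,v_n)$ be the burning sequence of a burning $(\lambda,S_G)$ of $G$. Then there is a spanning tree $T\subset G$ such that $S_G$ is a burning sequence for some burning of $T$.
   Context: All graphs are finite, simple and undirected, with non-empty vertex set. A tree is a connected graph without circuits. A spanning tree of $G$ is a (not necessarily induced) subgraph of $G$ that is a tree and contains all vertices of $G$. The distance $d_G(v,w)$ is the number of edges of a shortest path from $v$ to $w$ in $G$ ($\infty$ if there is none). For a vertex $v$ and an integer $r\ge 0$, $N_r(v)$ is the induced subgraph of $G$ on $\{w : d_G(v,w)\le r\}$. Let $S_G=(v_1,\dots,v_n)$, $n\ge 1$, be a sequence of distinct vertices of $G$. For $1\le j\le n$ let $\mathcal N_j$ be the induced subgraph of $G$ whose vertex set is the union of the vertex sets of $N_{j-i}(v_i)$, $1\le i\le j$. For $2\le j\le n+1$ let $U_j$ be the induced subgraph of $G$ whose vertex set is the union of the vertex sets of $N_{j-i}(v_i)$, $1\le i\le j-1$. The sequence $S_G$ is a burning sequence of $G$ if $v_j\notin U_j$ for $2\le j\le n$ and $U_{n+1}=G$. Put $\mathcal N_{n+1}=G$. A burning sequence $S_G$ determines the function $\lambda(v)=\min\{i : 1\le i\le n+1,\ v\in\mathcal N_i\}$ on vertices, and the pair $(\lambda,S_G)$ is called a burning of $G$. For a burning of $T$ all these notions are taken with respect to the graph $T$ and its distance $d_T$. *)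

(* Defs.v *)
From mathcomp Require Import all_boot.

Set Implicit Arguments.
Unset Strict Implicit.
Unset Printing Implicit Defensive.

Record sgraph (V : finType) := SGraph {
  edge :> rel V;
  edge_sym : symmetric edge;
  edge_irrefl : irreflexive edge;
  vertex_nonempty : 0 < #|V| }.

Section Graphs.
Variables (V : finType) (G : sgraph V).

Definition connected_graph : Prop := forall x y : V, connect G x y.

(* A circuit visits at least 3 distinct vertices; [cycle] also accepts
   [:: x; y] for every edge x y. *)
Definition circuit (c : seq V) : bool := [&& 2 < size c, uniq c & cycle G c].

Definition tree : Prop := connected_graph /\ forall c : seq V, ~~ circuit c.

Definition path_of_length (k : nat) (v w : V) : bool :=
  [exists p : k.-tuple V, [&& path G v p, uniq (v :: p) & last v p == w]].

(* [None] stands for infinity. A path has no repeated vertex, hence fewer than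
   #|V| edges, so searching the lengths below #|V| in increasing order finds a
   shortest path whenever there is a path. *)
Definition dist (v w : V) : option nat :=
  ohead [seq k <- iota 0 #|V| | path_of_length k v w].

(* Induced subgraphs are represented by their vertex sets; in particular [setT]
   represents G itself. *)
Definition ball (r : nat) (v : V) : {set V} :=
  [set w | if dist v w is Some d then d <= r else false].

Section Burning.
Variables (n : nat) (s : n.-tuple V).

(* The vertex v_i with 1 <= i <= n is [tnth s i'], where i' : 'I_n is i - 1;
   the index j below is 1-based. *)
Definition burnN (j : nat) : {set V} :=
  if j <= n then \bigcup_(i < n | i.+1 <= j) ball (j - i.+1) (tnth s i)
  else setT.

Definition burnU (j : nat) : {set V} :=
  \bigcup_(i < n | i.+1 <= j.-1) ball (j - i.+1) (tnth s i).

Definition burning_sequence : Prop :=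
  [/\ 0 < n,
      uniq s,
      forall j : 'I_n, 2 <= j.+1 -> tnth s j \notin burnU j.+1
    & burnU n.+1 = setT].

(* The default value n + 1 always belongs to the set whose minimum is taken. *)
Definition burn_lambda (v : V) : nat :=
  \big[minn/n.+1]_(1 <= i < n.+2 | v \in burnN i) i.

Definition burning (lambda : V -> nat) : Prop :=
  burning_sequence /\ forall v : V, lambda v = burn_lambda v.

End Burning.

End Graphs.

(* Both graphs live on the same vertex type, so T contains all vertices of G. *)
Definition spanning_tree (V : finType) (T G : sgraph V) : Prop :=
  subrel T G /\ tree T.

(* Main.v *)
Require Import Defs.
From mathcomp Require Import all_boot.

(** Let the fire time of a vertex w be the least k such that the fire of some
    source s_i (0-based, lit at time i) has reached w at time k, that is
    d(s_i, w) <= k - i.  A vertex reached at time k along a nontrivial walk has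
    a neighbour, the last but one vertex of the walk, that was reached at time
    k - 1 at the latest.  Letting each vertex point to a neighbour of strictly
    smaller fire time, when there is one, gives a parent function whose edges
    form a forest F ([parent_graph_acyclic]).  A vertex without a parent is
    itself a source, so following parents leads back to a source at a rate of
    at least one unit of fire time per edge: in F every vertex is reached no
    later than in G ([fire_forest]).

    Since G is connected, F extends to a spanning tree T of G: a circuit of G
    cannot lie in F, and deleting one of its edges outside F keeps the graph
    connected ([spanning_tree_extending]).  As F is contained in T, the burning
    of T still covers all vertices; as T is contained in G, distances in T are
    at least those in G, so no source burns in T before it is lit
    ([burnU_sub]). *)

Set Implicit Arguments.
Unset Strict Implicit.
Unset Printing Implicit Defensive.

(** * Balls and walks *)

Section Walks.
Variables (V : finType) (G : sgraph V).

(** Shortening a walk to a path only makes it shorter, so balls can be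
    described by arbitrary walks; these, unlike paths, can be extended by an
    edge without further checks. *)
Lemma ballP (r : nat) (v w : V) :
  reflect (exists p, [/\ path G v p, last v p = w & size p <= r])
          (w \in ball G r v).
Proof.
rewrite inE /dist; apply: (iffP idP) => [|[p [Gp <- le_p_r]]].
  case def_ks: [seq _ <- _ | _] => [|k ks] //= le_k_r.
  have: k \in k :: ks by rewrite mem_head.
  rewrite -def_ks mem_filter => /andP[/existsP[p /and3P[Gp _ /eqP <-]] _].
  by exists p; rewrite size_tuple.
case/shortenP: Gp => q Gq Uq /uniq_leq_size le_q_p.
have{le_q_p} le_q_r: size q <= r.
  by apply: leq_trans le_p_r; apply: le_q_p; case/andP: Uq.
have lt_q_V: size q < #|V|.
  by rewrite -[_.+1]/(size (v :: q)) -(card_uniqP Uq) max_card.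
set ks := [seq _ <- _ | _].
have ks_q: size q \in ks.
  rewrite mem_filter mem_iota lt_q_V !andbT.
  by apply/existsP; exists (in_tuple q); apply/and3P.
have: sorted leq ks by apply: (sorted_filter leq_trans); apply: iota_sorted.
case: ks ks_q => //= k ks; rewrite inE => /predU1P[<- // | ks_q].
move=> /(order_path_min leq_trans)/allP/(_ _ ks_q) le_k_q.
exact: leq_trans le_k_q le_q_r.
Qed.

End Walks.

Lemma ball_sub (V : finType) (H G : sgraph V) (r : nat) (v : V) :
  subrel H G -> ball H r v \subset ball G r v.
Proof.
move=> sHG; apply/subsetP=> w /ballP[p [Hp def_w le_p_r]].
by apply/ballP; exists p; split=> //; apply: sub_path Hp.
Qed.

Lemma burnU_sub (V : finType) (H G : sgraph V) (n : nat) (s : n.-tuple V)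
    (j : nat) :
  subrel H G -> burnU H s j \subset burnU G s j.
Proof.
move=> sHG; apply/subsetP=> w /bigcupP[i lt_i_j wi].
by apply/bigcupP; exists i => //; apply: (subsetP (ball_sub _ _ sHG)).
Qed.

(** * Extending a forest to a spanning tree *)

Lemma circuit_rot (V : finType) (G : sgraph V) (c : seq V) (x : V) :
    circuit G c -> x \in c ->
  exists y q, [/\ circuit G [:: x, y & q], next c x = y
                & c =i [:: x, y & q]].
Proof.
case/and3P=> size_c Uc Gc cx; have [i c' def_c] := rot_to cx.
have Uc' := Uc; rewrite -(rot_uniq i) def_c in Uc'.
case: c' => [|y q] in def_c Uc' *.
  by move: size_c; rewrite -(size_rot i) def_c.
exists y, q; split.
- by rewrite -def_c /circuit size_rot size_c rot_uniq Uc rot_cycle.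
- by rewrite -(next_rot i Uc) def_c /= eqxx.
- by move=> z; rewrite -def_c mem_rot.
Qed.

Section DeleteEdge.
Variables (V : finType) (G : sgraph V) (e : {set V}).

(** The deleted edge is given as the set of its ends, which makes the relation
    visibly symmetric. *)
Definition delete_edge_rel : rel V :=
  fun x y => G x y && ([set x; y] != e).

Lemma delete_edge_sym : symmetric delete_edge_rel.
Proof. by move=> x y; rewrite /delete_edge_rel edge_sym setUC. Qed.

Lemma delete_edge_irrefl : irreflexive delete_edge_rel.
Proof. by move=> x; rewrite /delete_edge_rel edge_irrefl. Qed.

Definition delete_edge : sgraph V :=
  SGraph delete_edge_sym delete_edge_irrefl (vertex_nonempty G).

End DeleteEdge.

(** The rest of the circuit is a detour between the ends of the deleted
    edge. *)
Lemma delete_edge_connected (V : finType) (G : sgraph V) (x y : V)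
    (q : seq V) :
    connected_graph G -> circuit G [:: x, y & q] ->
  connected_graph (delete_edge G [set x; y]).
Proof.
move=> connG /and3P[]; case: q => [|z q] //= _.
rewrite !inE !negb_or => /and3P[/and3P[xy xz _] /andP[yz yq] _].
case/and3P=> _ Gyz Gz; set H := delete_edge G _.
have Hyz: H y z.
  by rewrite /= /delete_edge_rel Gyz; apply/eqP=> /setP/(_ x);
     rewrite !inE eqxx (negPf xy) (negPf xz).
(* After the step from y to z the walk never returns to y. *)
have Hzx: path H z (rcons q x).
  apply: (sub_in_path (P := predC1 y)) Gz; last first.
    rewrite /= eq_sym yz /= all_rcons /= xy /=.
    by apply/allP=> u qu /=; apply: contraNneq yq => <-.
  move=> u v; rewrite !inE => uy vy Guv; rewrite /= /delete_edge_rel Guv.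
  apply/eqP=> /setP/(_ y); rewrite !inE eqxx orbT.
  by rewrite eq_sym (negPf uy) eq_sym (negPf vy).
have Hyx: connect H y x.
  by apply/connectP; exists (z :: rcons q x);
     rewrite /= ?last_rcons // -/H; apply/andP.
have Hsym: connect_sym H by apply: sym_connect_sym; apply: edge_sym.
move=> a b; apply: connect_sub (connG a b) => u v Guv.
have [euv | neuv] := eqVneq [set u; v] [set x; y]; last first.
  by apply: connect1; rewrite /= /delete_edge_rel Guv.
have /set2P uxy: u \in [set x; y] by rewrite -euv set21.
have /set2P vxy: v \in [set x; y] by rewrite -euv set22.
by case: uxy vxy => -> [] ->; rewrite // Hsym.
Qed.

(** Circuits have distinct vertices, so they have bounded length and can be
    searched for. *)
Lemma acyclic_or_circuit (V : finType) (G : sgraph V) :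
  (forall c, ~~ circuit G c) \/ exists c, circuit G c.
Proof.
have [/existsP[m /existsP[c Gc]] | noc] :=
  boolP [exists m : 'I_#|V|.+1, exists c : m.-tuple V, circuit G c].
  by right; exists c.
left=> c; apply: contra noc => Gc; have /and3P[_ Uc _] := Gc.
have lt_c: size c < #|V|.+1 by rewrite ltnS -(card_uniqP Uc) max_card.
by apply/existsP; exists (Ordinal lt_c); apply/existsP; exists (in_tuple c).
Qed.

(** By induction on the number of edges of G: as long as G has a circuit, some
    edge of that circuit is not in F and can be deleted. *)
Lemma spanning_tree_extending (V : finType) (F G : sgraph V) :
    connected_graph G -> subrel F G -> (forall c, ~~ circuit F c) ->
  exists2 T : sgraph V, subrel F T & spanning_tree T G.
Proof.
move=> + + acF.
have [m] := ubnP #|[set xy : V * V | G xy.1 xy.2]|.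
elim: m G => // m IHm G le_G_m connG sFG.
have [acG | [c Gc]] := acyclic_or_circuit G.
  by exists G => //; split.
have /and3P[size_c Uc _] := Gc.
have [x cx nFx]: exists2 x, x \in c & ~~ F x (next c x).
  apply/hasP; apply: contraR (acF c) => /hasPn Fc.
  apply/and3P; split=> //.
  by apply: cycle_from_next => // x /Fc; rewrite negbK.
have [y [q [Gxyq def_y _]]] := circuit_rot Gc cx; rewrite def_y in nFx.
have Gxy: G x y by have /and3P[_ _ /andP[]] := Gxyq.
have sHG: subrel (delete_edge G [set x; y]) G by move=> u v /andP[].
have [||| T sFT [sTH treeT]] := IHm (delete_edge G [set x; y]).
- rewrite -ltnS; apply: leq_trans le_G_m; rewrite ltnS; apply: proper_card.
  apply/properP; split; first by apply/subsetP=> u; rewrite !inE => /sHG.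
  by exists (x, y); rewrite !inE //= /delete_edge_rel eqxx andbF.
- exact: delete_edge_connected Gxyq.
- move=> u v Fuv; rewrite /= /delete_edge_rel sFG //=.
  apply: contra nFx => /eqP euv.
  have uv: u != v by apply: contraTneq Fuv => ->; rewrite edge_irrefl.
  have /set2P uxy: u \in [set x; y] by rewrite -euv set21.
  have /set2P vxy: v \in [set x; y] by rewrite -euv set22.
  case: uxy vxy uv Fuv => -> [] ->; rewrite ?eqxx //.
  by rewrite edge_sym.
by exists T => //; split=> // u v /sTH/sHG.
Qed.

(** * Forests of parent functions *)

Section ParentGraph.
Variables (V : finType) (V_gt0 : 0 < #|V|) (parent : V -> V).

(** Roots are the fixed points of [parent]. *)
Definition parent_rel : rel V :=
  fun x y => (x != y) && ((parent x == y) || (parent y == x)).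

Lemma parent_rel_sym : symmetric parent_rel.
Proof. by move=> x y; rewrite /parent_rel eq_sym orbC. Qed.

Lemma parent_rel_irrefl : irreflexive parent_rel.
Proof. by move=> x; rewrite /parent_rel eqxx. Qed.

Definition parent_graph : sgraph V :=
  SGraph parent_rel_sym parent_rel_irrefl V_gt0.

(** On a circuit, both neighbours of a vertex of maximal time would have to be
    its parent. *)
Lemma parent_graph_acyclic (time : V -> nat) :
    (forall x, parent x != x -> time (parent x) < time x) ->
  forall c, ~~ circuit parent_graph c.
Proof.
move=> lt_time c; apply/negP=> Fc.
have [x0 cx0]: exists x0, x0 \in c.
  by case: c Fc => // x0 c _; exists x0; rewrite mem_head.
case: (arg_maxnP time cx0) => x cx max_x.
have [y [q [Fxyq _ def_c]]] := circuit_rot Fc cx.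
have parent_x z: z \in c -> parent_graph x z -> parent x = z.
  move=> cz /andP[xz /orP[/eqP // | /eqP def_x]].
  have le_zx: time z <= time x := max_x z cz.
  by have:= lt_time z; rewrite def_x xz ltnNge le_zx => /(_ isT).
case/and3P: Fxyq; case/lastP: q def_c => // q z def_c _ /=.
rewrite rcons_path last_rcons => /and3P[_ + _] /andP[Fxy /andP[_ Fzx]].
rewrite mem_rcons inE negb_or => /andP[yz _].
case/eqP: yz; rewrite -(parent_x y) //; last by rewrite def_c !inE eqxx orbT.
apply: parent_x; last by rewrite edge_sym.
by rewrite def_c !inE mem_rcons mem_head !orbT.
Qed.

End ParentGraph.

(** * The fire forest *)

Section Fire.
Variables (V : finType) (n : nat) (s : n.-tuple V).

(** Time is 0-based: the source [tnth s i] is lit at time [i], and the whole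
    graph has to be burned at time [n]. *)
Definition burned (G : sgraph V) (k : nat) (w : V) : bool :=
  [exists i : 'I_n, (i <= k) && (w \in ball G (k - i) (tnth s i))].

Lemma burnedP (G : sgraph V) (k : nat) (w : V) :
  reflect (exists (i : 'I_n) p,
             [/\ path G (tnth s i) p, last (tnth s i) p = w & i + size p <= k])
          (burned G k w).
Proof.
apply: (iffP existsP) => [[i /andP[le_ik /ballP[p [Gp def_w le_p]]]] |].
  by exists i, p; split; rewrite // -leq_subRL.
case=> i [p [Gp def_w le_k]]; have le_ik := leq_trans (leq_addr _ _) le_k.
by exists i; rewrite le_ik; apply/ballP; exists p; rewrite leq_subRL.
Qed.

Lemma burnU_last (G : sgraph V) :
  burnU G s n.+1 = setT <-> forall w, burned G n w.
Proof.
have memU w: (w \in burnU G s n.+1) = burned G n w.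
  apply/bigcupP/existsP=> [[i lt_in wi] | [i /andP[_ wi]]]; exists i => //.
  by rewrite subSS in wi; rewrite wi ltnW.
split=> [UT w | bG]; first by rewrite -memU UT inE.
by apply/setP=> w; rewrite memU bG inE.
Qed.

Lemma burned_sub (H G : sgraph V) (k : nat) (w : V) :
  subrel H G -> burned H k w -> burned G k w.
Proof.
move=> sHG /existsP[i /andP[le_ik wi]]; apply/existsP; exists i.
by rewrite le_ik; apply: (subsetP (ball_sub _ _ sHG)).
Qed.

Lemma burned_le (G : sgraph V) (j k : nat) (w : V) :
  j <= k -> burned G j w -> burned G k w.
Proof.
move=> le_jk /burnedP[i [p [Gp def_w le_j]]].
by apply/burnedP; exists i, p; split=> //; apply: leq_trans le_jk.
Qed.

Lemma burned_step (G : sgraph V) (k : nat) (u w : V) :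
  burned G k u -> G u w -> burned G k.+1 w.
Proof.
move=> /burnedP[i [p [Gp def_u le_k]]] Guw.
apply/burnedP; exists i, (rcons p w).
by rewrite rcons_path last_rcons size_rcons def_u Gp addnS ltnS.
Qed.

Lemma burned_inv (G : sgraph V) (k : nat) (w : V) :
    burned G k w ->
  (exists2 i : 'I_n, i <= k & w = tnth s i)
  \/ exists u j, [/\ G u w, j < k & burned G j u].
Proof.
case/burnedP=> i [p [+ + le_k]]; case/lastP: p le_k => [|p w'] le_k.
  by left; exists i => //; rewrite addn0 in le_k.
rewrite rcons_path last_rcons size_rcons addnS in le_k * => /andP[Gp Guw] <-.
right; exists (last (tnth s i) p), (i + size p); split=> //.
by apply/burnedP; exists i, p.
Qed.

(** The parent of a vertex may be any neighbour of smaller fire time, also for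
    a source: by induction, a vertex of fire time k whose parent is reached by
    time k - 1 in the forest is reached by time k. *)
Lemma fire_forest (G : sgraph V) (k : nat) :
    (forall w, burned G k w) ->
  exists F : sgraph V,
    [/\ subrel F G, forall c, ~~ circuit F c & forall w, burned F k w].
Proof.
move=> bG; have exb w: exists j, burned G j w by exists k.
pose time w := ex_minn (exb w).
have b_time w: burned G (time w) w by rewrite /time; case: ex_minnP.
have time_le w j: burned G j w -> time w <= j.
  by rewrite /time; case: ex_minnP => m _ min_m /min_m.
pose earlier w u := G u w && (time u < time w).
pose parent w := odflt w (pick (earlier w)).
have parentP w: parent w != w -> earlier w (parent w).
  by rewrite /parent; case: pickP => [u //|_]; rewrite eqxx.
pose F := parent_graph (vertex_nonempty G) parent.
have sFG: subrel F G.
  move=> x y /andP[xy /orP[]/eqP def_p]; rewrite -def_p in xy *.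
    by rewrite edge_sym; rewrite eq_sym in xy; case/andP: (parentP x xy).
  by case/andP: (parentP y xy).
exists F; split=> //.
  by apply: (@parent_graph_acyclic _ _ _ time) => x /parentP/andP[].
suff bF w: burned F (time w) w.
  by move=> w; apply: burned_le (bF w); apply: time_le.
have [m] := ubnP (time w); elim: m w => // m IHm w; rewrite ltnS => le_w_m.
have [root_w | nroot_w] := eqVneq (parent w) w; last first.
  have /andP[_ lt_time] := parentP w nroot_w.
  apply: (burned_le lt_time); apply: burned_step (IHm _ _) _.
    exact: leq_trans lt_time le_w_m.
  by rewrite /= /parent_rel nroot_w eqxx orbT.
have [[i le_i def_w] | [u [j [Guw lt_j bju]]]] := burned_inv (b_time w).
  by apply/burnedP; exists i, [::]; rewrite addn0.
have e_u: earlier w u by rewrite /earlier Guw (leq_ltn_trans (time_le _ _ bju)).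
move: root_w; rewrite /parent; case: pickP => [v e_v /= def_v | /(_ u)].
  by case/andP: e_v; rewrite def_v edge_irrefl.
by rewrite e_u.
Qed.

End Fire.

(** * Spanning trees with the same burning sequence *)

Theorem theorem3p2 (V : finType) (G : sgraph V) (n : nat) (s : n.-tuple V)
    (lambda : V -> nat) :
  connected_graph G ->
  burning G s lambda ->
  exists T : sgraph V,
    spanning_tree T G /\ exists lambda' : V -> nat, burning T s lambda'.
Proof.
move=> connG [[n_gt0 Us notU coverU] _].
have [F [sFG acF bF]] := fire_forest (proj1 (burnU_last s G) coverU).
have [T sFT spanT] := spanning_tree_extending connG sFG acF.
have [sTG _] := spanT.
exists T; split=> //; exists (burn_lambda T s); split=> //; split=> //.
  move=> j j_ge2; apply: contra (notU j j_ge2).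
  exact/subsetP/burnU_sub.
by apply/burnU_last=> w; apply: burned_sub (bF w).
Qed.
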